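(* Let $k,n$ be positive integers and let $G$ be a $k$-regular bipartite finite simple graph of order $n$. Then the number of subgraphs of $G$ isomorphic to the cycle $C_4$ and the number of subgraphs of $G$ isomorphic to the path $P_4$ are determined by $Q(G;x,y)$; that is, if $G'$ is another $k$-regular bipartite graph of order $n$ with $Q(G';x,y)=Q(G;x,y)$, then $G$ and $G'$ have the same number of subgraphs isomorphic to $C_4$ and the same number of subgraphs isomorphic to $P_4$.
   Context: For a finite simple graph $G=(V,E)$, the subgraph component polynomial is $Q(G;x,y)=\sum_{X\subseteq V} x^{|X|}y^{k(G[X])}$, where $G[X]$ is the induced subgraph on $X$ and $k(\cdot)$ denotes the number of connected components. $P_4$ is the path on 4 vertices and $C_4$ the cycle on 4 vertices. *)

(* Defs.v *)
From mathcomp Require Import all_boot all_order all_algebra.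

Set Implicit Arguments.
Unset Strict Implicit.
Unset Printing Implicit Defensive.

Import GRing.Theory.
Local Open Scope ring_scope.

Record sgraph := SGraph {
  vertex :> finType;
  adj : rel vertex;
  adj_sym : symmetric adj;
  adj_irrefl : irreflexive adj }.

Definition edges (G : sgraph) : {set {set G}} :=
  [set [set p.1; p.2] | p : G * G & adj p.1 p.2].

Section InducedSubgraph.
Variables (G : sgraph) (X : {set G}).

Definition induced_adj : rel {x : G | x \in X} :=
  [rel u v | adj (val u) (val v)].

Lemma induced_adj_sym : symmetric induced_adj.
Proof. by move=> u v; apply: adj_sym. Qed.

Lemma induced_adj_irrefl : irreflexive induced_adj.
Proof. by move=> u; apply: adj_irrefl. Qed.

Definition induced : sgraph := SGraph induced_adj_sym induced_adj_irrefl.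
End InducedSubgraph.

(* The connected components are the classes of [connect], which is an
   equivalence relation because [adj] is symmetric. *)
Definition num_components (G : sgraph) : nat := n_comp (@adj G) G.

(* In {poly {poly int}} the outer variable plays the role of x, and the
   constant polynomial 'X%:P that of y. *)
Definition subgraph_component_poly (G : sgraph) : {poly {poly int}} :=
  \sum_(X : {set G}) 'X^#|X| * ('X%:P) ^+ num_components (induced X).

Definition regular (k : nat) (G : sgraph) : Prop :=
  forall x : G, #|[set y | adj x y]| = k.

Definition bipartite (G : sgraph) : Prop :=
  exists A : {set G}, forall x y : G, adj x y -> (x \in A) != (y \in A).

Definition isomorphic (H K : sgraph) : bool :=
  [exists f : {ffun H -> K},
    [&& injectiveb f, [forall y, exists x, f x == y]
      & [forall u, forall v, adj (f u) (f v) == adj u v]]].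

(* A subgraph is given by its vertex set and its edge set, and need not be
   induced. *)
Definition is_subgraph (G : sgraph) (S : {set G} * {set {set G}}) : bool :=
  (S.2 \subset edges G) && [forall e in S.2, e \subset S.1].

Section SubgraphAsGraph.
Variables (G : sgraph) (S : {set G} * {set {set G}}).

(* The conjunct [adj] is redundant when [is_subgraph S] holds; it makes the
   relation irreflexive for an arbitrary S. *)
Definition subgraph_adj : rel {x : G | x \in S.1} :=
  [rel u v | adj (val u) (val v) && ([set val u; val v] \in S.2)].

Lemma subgraph_adj_sym : symmetric subgraph_adj.
Proof. by move=> u v; rewrite /subgraph_adj /= (adj_sym (val u)) setUC. Qed.

Lemma subgraph_adj_irrefl : irreflexive subgraph_adj.
Proof. by move=> u; rewrite /subgraph_adj /= (adj_irrefl (val u)). Qed.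

Definition graph_of_subgraph : sgraph :=
  SGraph subgraph_adj_sym subgraph_adj_irrefl.
End SubgraphAsGraph.

Definition num_subgraphs (H G : sgraph) : nat :=
  #|[set S : {set G} * {set {set G}} |
      is_subgraph S & isomorphic (graph_of_subgraph S) H]|.

Definition P4_adj : rel 'I_4 :=
  [rel u v : 'I_4 | (u.+1 == v :> nat) || (v.+1 == u :> nat)].

Lemma P4_adj_sym : symmetric P4_adj.
Proof. by move=> u v; apply: orbC. Qed.

Lemma P4_adj_irrefl : irreflexive P4_adj.
Proof. by case=> [[|[|[|[|m]]]] lt_m4]. Qed.

Definition P4 : sgraph := SGraph P4_adj_sym P4_adj_irrefl.

Definition C4_adj : rel 'I_4 :=
  [rel u v : 'I_4 | (ordS u == v) || (ordS v == u)].

Lemma C4_adj_sym : symmetric C4_adj.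
Proof. by move=> u v; apply: orbC. Qed.

Lemma C4_adj_irrefl : irreflexive C4_adj.
Proof. by case=> [[|[|[|[|m]]]] lt_m4]. Qed.

Definition C4 : sgraph := SGraph C4_adj_sym C4_adj_irrefl.

(* Main.v *)
Require Import Defs.
From mathcomp Require Import all_boot all_order all_algebra zify.

Set Implicit Arguments.
Unset Strict Implicit.
Unset Printing Implicit Defensive.

Import GRing.Theory.

(* In a k-regular bipartite graph the numbers of copies of P4 and of K_{1,3}
   depend on k and n only: a P4 is grown edge by edge (its ends lie on opposite
   sides, hence differ), a claw is grown from its centre.  A connected bipartite
   graph on four vertices is P4, K_{1,3} or C4, so the coefficient of x^4 y in Q
   is p + s + c, the numbers of induced copies of these.  Claws and 4-cycles are
   always induced, while a 4-cycle contains four non-induced copies of P4; hence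
   #P4 = p + 4c, and c is determined.  All counting is done with ordered
   quadruples: the number of embeddings of H is |Aut H| times the number of
   subgraphs isomorphic to H. *)

(** * Embeddings, automorphisms and subgraph counts *)

Definition embeddings (H G : sgraph) : {set {ffun H -> G}} :=
  [set f : {ffun H -> G} |
    injectiveb f & [forall u, forall v, adj u v ==> adj (f u) (f v)]].

Definition automorphisms (H : sgraph) : {set {ffun H -> H}} :=
  [set s : {ffun H -> H} |
    injectiveb s & [forall u, forall v, adj (s u) (s v) == adj u v]].

Definition image_subgraph (H G : sgraph) (f : {ffun H -> G}) :
    {set G} * {set {set G}} :=
  (f @: [set: H], [set [set f p.1; f p.2] | p : H * H & adj p.1 p.2]).

Lemma embeddingsP (H G : sgraph) (f : {ffun H -> G}) :
  reflect (injective f /\ forall u v, adj u v -> adj (f u) (f v))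
          (f \in embeddings H G).
Proof.
rewrite inE; apply: (iffP andP) => [[/injectiveP inj_f /forallP hom_f]|].
  split=> // u v uv; by move/forallP/(_ v)/implyP/(_ uv): (hom_f u).
case=> inj_f hom_f; split; first exact/injectiveP.
by apply/forallP=> u; apply/forallP=> v; apply/implyP/hom_f.
Qed.

Lemma automorphismsP (H : sgraph) (s : {ffun H -> H}) :
  reflect (injective s /\ forall u v, adj (s u) (s v) = adj u v)
          (s \in automorphisms H).
Proof.
rewrite inE; apply: (iffP andP) => [[/injectiveP inj_s /forallP hom_s]|].
  by split=> // u v; apply/eqP; move/forallP: (hom_s u).
case=> inj_s hom_s; split; first exact/injectiveP.
by apply/forallP=> u; apply/forallP=> v; apply/eqP/hom_s.
Qed.

Lemma automorphisms_gt0 (H : sgraph) : 0 < #|automorphisms H|.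
Proof.
apply/card_gt0P; exists [ffun u => u]; apply/automorphismsP.
by split=> u v; rewrite !ffunE.
Qed.

Lemma isomorphicP (H K : sgraph) :
  reflect (exists f : H -> K, bijective f /\ forall u v, adj (f u) (f v) = adj u v)
          (isomorphic H K).
Proof.
apply: (iffP existsP) => [[f /and3P[/injectiveP inj_f /forallP sur_f /forallP adj_f]]|].
  exists f; split; last by move=> u v; apply/eqP; move/forallP: (adj_f u).
  apply: (inj_card_bij inj_f); rewrite -(card_codom inj_f).
  apply: subset_leq_card; apply/subsetP=> y _.
  by have /existsP[x /eqP <-] := sur_f y; apply: codom_f.
case=> f [[f' fK f'K] adj_f]; exists [ffun x => f x]; apply/and3P; split.
- by apply/injectiveP=> x y; rewrite !ffunE => /(can_inj fK).
- by apply/forallP=> y; apply/existsP; exists (f' y); rewrite ffunE f'K.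
- by apply/forallP=> u; apply/forallP=> v; rewrite !ffunE adj_f.
Qed.

Section ImageSubgraph.
Variables (H G : sgraph) (f : {ffun H -> G}).
Hypothesis emb_f : f \in embeddings H G.

(** Injectivity of [f] lets an unordered pair of images come from only one unordered pair of [H], so
    the image acquires no edge beyond those of [H]. *)
Lemma image_edgeE u v :
  ([set f u; f v] \in (image_subgraph f).2) = adj u v.
Proof.
have [inj_f _] := embeddingsP _ emb_f.
apply/imsetP/idP => [[[u' v']]|uv]; last by exists (u, v); rewrite ?inE.
rewrite inE /= => uv' /setP eq_e.
(* Testing the equality of the two pairs at all four endpoints leaves only [(u, v) = (u', v')] and
   the swapped case. *)
have := eq_e (f u); have := eq_e (f v); have := eq_e (f u'); have := eq_e (f v').
rewrite !inE !(inj_eq inj_f) !eqxx /= !orbT.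
have neq: u' != v' by apply: contraTneq uv' => ->; rewrite adj_irrefl.
do 2!case/orP => /eqP ?; subst => //; rewrite ?eqxx // in neq.
all: by rewrite ?(adj_sym v') //  adj_sym.
Qed.

Lemma image_subgraph_iso :
  is_subgraph (image_subgraph f)
  && isomorphic (graph_of_subgraph (image_subgraph f)) H.
Proof.
have [inj_f hom_f] := embeddingsP _ emb_f.
apply/andP; split.
  apply/andP; split.
    apply/subsetP=> _ /imsetP[[u v] + ->]; rewrite inE => uv.
    by apply/imsetP; exists (f u, f v); rewrite ?inE //= hom_f.
  apply/forall_inP=> _ /imsetP[[u v] _ ->].
  by apply/subsetP=> x; rewrite !inE => /orP[] /eqP ->; apply: imset_f.
have fS u : f u \in (image_subgraph f).1 by apply: imset_f.
have [h hK] : exists h : graph_of_subgraph (image_subgraph f) -> H,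
    forall x, f (h x) = val x.
  have ex (x : graph_of_subgraph (image_subgraph f)) : exists u, f u == val x.
    by case: x => /= x /imsetP[u _ ->]; exists u.
  by exists (fun x => xchoose (ex x)) => x; apply/eqP/(xchooseP (ex x)).
apply/isomorphicP; exists h; split.
  exists (fun u => Sub (f u) (fS u)) => [x|u]; last by apply: inj_f; rewrite hK.
  by apply: val_inj; rewrite /= hK.
move=> x y; rewrite [RHS]/adj /= /subgraph_adj [RHS]/= -!hK image_edgeE.
by apply/esym/andb_idl/hom_f.
Qed.
End ImageSubgraph.

(** Once an isomorphism [g] from [S] to [H] is fixed, the embeddings with image [S] are exactly the
    automorphisms of [H] followed by the inverse of [g]. *)
Lemma card_embeddings_onto (H G : sgraph) (S : {set G} * {set {set G}}) :
  is_subgraph S -> isomorphic (graph_of_subgraph S) H ->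
  #|[set f in embeddings H G | image_subgraph f == S]| = #|automorphisms H|.
Proof.
case/andP=> /subsetP edgeS /forall_inP vertS /isomorphicP[g [[g' gK g'K] adj_g]].
have adj_g' u v : adj (g' u) (g' v) = adj u v by rewrite -adj_g !g'K.
pose phi (s : {ffun H -> H}) : {ffun H -> G} := [ffun u => val (g' (s u))].
have inj_phi : injective phi.
  move=> s t /ffunP eq_st; apply/ffunP=> u; apply: (can_inj g'K).
  by apply: val_inj; have := eq_st u; rewrite !ffunE.
rewrite -(card_imset _ inj_phi); apply: eq_card => f; rewrite inE.
apply/andP/imsetP => [[emb_f /eqP defS]|[s /automorphismsP[inj_s adj_s] ->]].
  have [inj_f hom_f] := embeddingsP _ emb_f.
  have fS u : f u \in S.1 by rewrite -defS imset_f.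
  (* The automorphism is [f] read back in [H] through [g]. *)
  exists [ffun u => g (Sub (f u) (fS u))]; last first.
    by apply/ffunP=> u; rewrite !ffunE gK.
  apply/automorphismsP; split=> u v.
    by rewrite !ffunE => /(can_inj gK)/(congr1 val)/inj_f.
  have edgeE : ([set f u; f v] \in S.2) = adj u v by rewrite -defS image_edgeE.
  rewrite !ffunE adj_g [LHS]/adj /= /subgraph_adj /= edgeE.
  exact/andb_idl/hom_f.
have emb : phi s \in embeddings H G.
  apply/embeddingsP; split=> u v; rewrite !ffunE.
    by move/val_inj/(can_inj g'K)/inj_s.
  by rewrite -adj_s -adj_g' => /andP[].
split=> //; apply/eqP; rewrite [RHS]surjective_pairing; congr (_, _).
  apply/setP=> x; apply/imsetP/idP => [[u _ ->]|xS]; first by rewrite ffunE (valP (g' _)).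
  exists (invF inj_s (g (Sub x xS))) => //.
  by rewrite ffunE f_invF gK.
apply/setP=> e; apply/imsetP/idP => [[[u v]]|eS].
  rewrite inE /= => uv ->; rewrite !ffunE.
  by move: uv; rewrite -adj_s -adj_g' => /andP[].
have /imsetP[[x y] + def_e] := edgeS e eS; rewrite inE /= in def_e * => xy.
have /subsetP sub_e := vertS e eS.
have xS : x \in S.1 by apply: sub_e; rewrite def_e !inE eqxx.
have yS : y \in S.1 by apply: sub_e; rewrite def_e !inE eqxx orbT.
exists (invF inj_s (g (Sub x xS)), invF inj_s (g (Sub y yS))).
  by rewrite inE /= -adj_s !f_invF adj_g /adj /= /subgraph_adj /= xy -def_e.
by rewrite /= !ffunE !f_invF !gK.
Qed.

Lemma card_embeddings (H G : sgraph) :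
  #|embeddings H G| = #|automorphisms H| * num_subgraphs H G.
Proof.
pose P (S : {set G} * {set {set G}}) :=
  is_subgraph S && isomorphic (graph_of_subgraph S) H.
rewrite -sum1_card (partition_big (@image_subgraph H G) P) => [|f /image_subgraph_iso //].
rewrite (eq_bigr (fun=> #|automorphisms H|)) => [|S /andP[subS isoS]]; last first.
  rewrite -(card_embeddings_onto subS isoS) -sum1_card.
  by apply: eq_bigl => f; rewrite inE.
rewrite sum_nat_const mulnC; congr (_ * _).
by apply: eq_card => S; rewrite inE.
Qed.

Lemma num_subgraphs_eq (H G G' : sgraph) :
  #|embeddings H G| = #|embeddings H G'| ->
  num_subgraphs H G = num_subgraphs H G'.
Proof.
rewrite !card_embeddings => /eqP.
by rewrite eqn_pmul2l ?automorphisms_gt0 // => /eqP.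
Qed.

(** * Ordered quadruples and their reorderings *)

Section Quadruples.
Variable T : finType.

Definition quad_ffun (p : T * T * T * T) : {ffun 'I_4 -> T} :=
  let: (a, b, c, d) := p in [ffun i : 'I_4 => nth a [:: a; b; c; d] i].

Definition uniq4 (p : T * T * T * T) : bool :=
  let: (a, b, c, d) := p in uniq [:: a; b; c; d].

(** The default [a] of [nth] is never reached when [is_perm4 s] holds, since all indices are then
    below 4. *)
Definition permute4 (s : nat * nat * nat * nat) (p : T * T * T * T) :
    T * T * T * T :=
  let: (i, j, k, l) := s in let: (a, b, c, d) := p in
  let x := nth a [:: a; b; c; d] in (x i, x j, x k, x l).

(* The labelled copies of P4, K_{1,3} and C4 on {0, 1, 2, 3}: one vertex ordering
   for each, so 4!/2, 4!/6 and 4!/8 of them. *)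
Definition paths4 : seq (nat * nat * nat * nat) :=
  [:: (0, 1, 2, 3); (0, 2, 1, 3); (0, 1, 3, 2); (0, 3, 1, 2);
      (0, 2, 3, 1); (0, 3, 2, 1); (1, 0, 3, 2); (1, 3, 0, 2);
      (1, 0, 2, 3); (1, 2, 0, 3); (2, 0, 1, 3); (2, 1, 0, 3)].

Definition claws4 : seq (nat * nat * nat * nat) :=
  [:: (0, 1, 2, 3); (1, 0, 2, 3); (2, 0, 1, 3); (3, 0, 1, 2)].

Definition cycles4 : seq (nat * nat * nat * nat) :=
  [:: (0, 1, 2, 3); (0, 1, 3, 2); (0, 2, 1, 3)].

Definition is_perm4 (s : nat * nat * nat * nat) : bool :=
  let: (i, j, k, l) := s in perm_eq [:: i; j; k; l] (iota 0 4).

(** Every position 0, ..., 3 occurs among the indices in [s], so the reordered quadruple still shows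
    every entry. *)
Lemma permute4_inj s : is_perm4 s -> injective (permute4 s).
Proof.
case: s => [[[i j] k] l] ps [[[a b] c] d] [[[a' b'] c'] d'].
pose t := [:: a; b; c; d]; pose t' := [:: a'; b'; c'; d'].
have ps4 x : x < 4 -> x \in [:: i; j; k; l].
  by move=> x4; rewrite (perm_mem ps) mem_iota.
rewrite /permute4 => -[ei ej ek el].
have eq_nth x : x < 4 -> nth a t x = nth a' t' x.
  by move/ps4; rewrite !inE => /or4P[] /eqP ->.
by have [/= -> -> -> ->] := And4 (eq_nth 0 isT) (eq_nth 1 isT) (eq_nth 2 isT)
  (eq_nth 3 isT).
Qed.

Lemma uniq4_permute s p : is_perm4 s -> uniq4 (permute4 s p) = uniq4 p.
Proof.
case: s p => [[[i j] k] l] [[[a b] c] d] ps.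
rewrite /uniq4 /permute4.
rewrite -[[:: nth _ _ i; _; _; _]]/[seq nth a [:: a; b; c; d] x | x <- [:: i; j; k; l]].
by apply/perm_uniq/(perm_trans (perm_map _ ps)).
Qed.

Definition count4 (E : T * T * T * T -> bool) : nat :=
  \sum_p (uniq4 p && E p).

(** Each reordering permutes the quadruples and preserves distinctness, so reindexing shows that
    every labelled copy of a pattern contributes the same total [count4 E]. *)
Lemma sum_permute4 ss (E : T * T * T * T -> bool) : all is_perm4 ss ->
  \sum_p uniq4 p * \sum_(s <- ss) E (permute4 s p) = \sum_(s <- ss) count4 E.
Proof.
move/allP=> pss; under eq_bigr do rewrite big_distrr /=.
rewrite exchange_big /=; apply: eq_big_seq => s /pss ps.
rewrite /count4 [RHS](reindex_inj (permute4_inj ps)).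
by apply: eq_bigr => p _; rewrite uniq4_permute // mulnb.
Qed.

Lemma quad_ffun_bij : bijective quad_ffun.
Proof.
pose x (i : nat) (f : {ffun 'I_4 -> T}) := f (inord i).
exists (fun f => (x 0 f, x 1 f, x 2 f, x 3 f)).
  by case=> [[[a b] c] d]; rewrite /x /= !ffunE !inordK.
move=> f; apply/ffunP=> i; rewrite ffunE.
case: i => [[|[|[|[|m]]]] lt_m] //=; congr (f _); apply: val_inj;
  by rewrite /= inordK.
Qed.

Lemma card_quads (A : {set {ffun 'I_4 -> T}}) : #|A| = \sum_p (quad_ffun p \in A).
Proof.
rewrite -sum1_card big_mkcond /= (reindex quad_ffun) /=; last exact/onW_bij/quad_ffun_bij.
by apply: eq_bigr => p _; case: ifP.
Qed.

Lemma injectiveb_quad p : injectiveb (quad_ffun p) = uniq4 p.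
Proof.
case: p => [[[a b] c] d]; apply/injectiveP/idP => [inj_f|uniq_p x y].
  have neq (i j : 'I_4) : i != j -> nth a [:: a; b; c; d] i != nth a [:: a; b; c; d] j.
    by apply: contraNneq => eq_ij; apply/eqP/inj_f; rewrite !ffunE eq_ij.
  rewrite /= !inE !negb_or.
  by rewrite (neq (@Ordinal 4 0 isT) (@Ordinal 4 1 isT)) //
    (neq (@Ordinal 4 0 isT) (@Ordinal 4 2 isT)) //
    (neq (@Ordinal 4 0 isT) (@Ordinal 4 3 isT)) //
    (neq (@Ordinal 4 1 isT) (@Ordinal 4 2 isT)) //
    (neq (@Ordinal 4 1 isT) (@Ordinal 4 3 isT)) //
    (neq (@Ordinal 4 2 isT) (@Ordinal 4 3 isT)).
rewrite !ffunE => /eqP; rewrite nth_uniq // => /eqP; exact: val_inj.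
Qed.

Lemma imset_quad a b c d :
  quad_ffun (a, b, c, d) @: [set: 'I_4] = [set a; b; c; d].
Proof.
apply/setP=> x; rewrite !inE; apply/imsetP/idP => [[i _ ->]|].
  by rewrite ffunE; case: i => [[|[|[|[|m]]]] lt_m] //=; rewrite eqxx ?orbT.
have P (i : 'I_4) : nth a [:: a; b; c; d] i == x ->
    exists2 i, i \in [set: 'I_4] & x = quad_ffun (a, b, c, d) i.
  by exists i => //; rewrite ffunE; apply/esym/eqP.
rewrite -!orbA !(eq_sym x) => /or4P[].
- exact: (P (@Ordinal 4 0 isT)).
- exact: (P (@Ordinal 4 1 isT)).
- exact: (P (@Ordinal 4 2 isT)).
- exact: (P (@Ordinal 4 3 isT)).
Qed.

(** A set of four elements is the image of 4! = 24 injective maps from ['I_4]; this moves the count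
    from sets to quadruples. *)
Lemma card_sets4 (P : pred {set T}) :
  24 * #|[set X : {set T} | #|X| == 4 & P X]| =
  count4 (fun p => let: (a, b, c, d) := p in P [set a; b; c; d]).
Proof.
pose A := [set f : {ffun 'I_4 -> T} | injectiveb f & P (f @: [set: 'I_4])].
transitivity #|A|; last first.
  rewrite card_quads; apply: eq_bigr => -[[[a b] c] d] _.
  by rewrite inE injectiveb_quad imset_quad.
have im4 (f : {ffun 'I_4 -> T}) : injectiveb f -> #|f @: [set: 'I_4]| = 4.
  by move/injectiveP=> inj_f; rewrite card_imset // cardsT card_ord.
rewrite -[RHS]sum1_card.
rewrite (partition_big (fun f : {ffun 'I_4 -> T} => f @: [set: 'I_4])
  (fun X => (#|X| == 4) && P X)) => [|f]; last first.
  by rewrite !inE => /andP[/im4 -> ->].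
rewrite (eq_bigr (fun=> 24)) => [|X /andP[/eqP X4 PX]].
  by rewrite sum_nat_const mulnC cardsE.
(* The maps with image [X] are the injections into [X], because an injection between sets of size 4
   is onto. *)
transitivity #|[set f : {ffun 'I_4 -> T} in ffun_on (mem X) | injectiveb f]|; last first.
  by rewrite card_inj_ffuns_on card_ord X4.
rewrite -sum1_card; apply: eq_bigl => f; rewrite !inE andbC.
have [inj_f|_] := boolP (injectiveb f); last by rewrite !andbF.
rewrite andbT; apply/andP/ffun_onP => [[/eqP <- _] i|fX]; first exact: imset_f.
have eqX : f @: [set: 'I_4] = X.
  apply/eqP; rewrite eqEcard im4 // X4 leqnn andbT.
  by apply/subsetP=> _ /imsetP[i _ ->]; apply: fX.
by rewrite eqX eqxx.
Qed.

End Quadruples.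

(** * Coefficients of Q and connectedness of four-vertex sets *)

Lemma coef_subgraph_component_poly (G : sgraph) (i j : nat) :
  (((subgraph_component_poly G)`_i)`_j =
   #|[set X : {set G} | #|X| == i & num_components (induced X) == j]|%:R)%R.
Proof.
rewrite /subgraph_component_poly !coef_sum -sum1_card natr_sum [RHS]big_mkcond /=.
apply: eq_bigr => X _.
(* The power of y is a constant of the outer ring, so the coefficient of the single monomial of [X]
   is a product of two indicators. *)
rewrite -rmorphXn /= mulrC coefCM coefXn mulr_natr coefMn coefXn -mulr_natr.
rewrite inE !(eq_sym _ i) !(eq_sym _ j).
by case: (i == _); case: (j == _); rewrite ?mulr0 ?mulr1.
Qed.

(** The component of [x0] is the least set that contains it and is closed under adjacency within
    [X]. Phrasing connectedness by cuts rather than paths makes it a finite Boolean condition on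
    four vertices. *)
Lemma induced_connectedP (G : sgraph) (X : {set G}) (x0 : G) : x0 \in X ->
  reflect (forall A : {set G}, x0 \in A ->
             (forall x y, x \in X -> y \in X -> adj x y -> x \in A -> y \in A) ->
             X \subset A)
          (num_components (induced X) == 1).
Proof.
move=> Xx0; pose u0 : induced X := Sub x0 Xx0.
have csym : connect_sym (@adj (induced X)) by apply/sym_connect_sym/adj_sym.
apply: (iffP idP) => [|cutX].
  rewrite /num_components /n_comp_mem => /card1P[r rP] A Ax0 closA.
  apply/subsetP=> x Xx; pose u : induced X := Sub x Xx.
  have rootE v : fingraph.root (@adj (induced X)) v = r.
    by apply/eqP; rewrite -[_ == r]rP inE /= (roots_root csym).
  have closed_A : closed (@adj (induced X)) [pred v | val v \in A].
    apply: intro_closed => // v w vw; rewrite !inE.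
    by apply: closA vw; apply: valP.
  have u0u : connect (@adj (induced X)) u0 u by rewrite -(root_connect csym) !rootE.
  by have := closed_connect closed_A u0u; rewrite !inE /= Ax0 => <-.
suff all_connect : connect (@adj (induced X)) u0 =i induced X.
  by rewrite /num_components -(eq_n_comp_r all_connect) n_comp_connect.
move=> u; rewrite [RHS]inE.
(* The closed set to test is the component of [u0] itself. *)
pose A := [set val v | v : induced X in connect (@adj (induced X)) u0].
have /subsetP/(_ (val u) (valP u)) : X \subset A.
  apply: cutX => [|x y Xx Xy xy /imsetP[v u0v def_x]].
    by apply/imsetP; exists u0 => //; apply: connect0.
  apply/imsetP; exists (Sub y Xy) => //.
  apply: (connect_trans u0v); apply: connect1.
  by rewrite /adj /= /induced_adj /= -def_x.
by case/imsetP=> v u0v /val_inj ->.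
Qed.

(* Each conjunct says that an edge crosses one of the seven cuts of
   {a, b, c, d}. *)
Definition spanning4 (G : sgraph) (a b c d : G) : bool :=
  [&& [|| adj a b, adj a c | adj a d],
      [|| adj a b, adj b c | adj b d],
      [|| adj a c, adj b c | adj c d],
      [|| adj a d, adj b d | adj c d],
      [|| adj a c, adj a d, adj b c | adj b d],
      [|| adj a b, adj a d, adj b c | adj c d] &
      [|| adj a b, adj a c, adj b d | adj c d]].

Lemma num_components_set4 (G : sgraph) (a b c d : G) : uniq [:: a; b; c; d] ->
  (num_components (induced [set a; b; c; d]) == 1) = spanning4 a b c d.
Proof.
rewrite /= !inE !negb_or andbT.
case/and3P=> /and3P[ab ac ad] /andP[bc bd] cd.
have Xa : a \in [set a; b; c; d] by rewrite !inE eqxx.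
apply/(induced_connectedP Xa)/idP => [cutX|span A Aa closA].
  (* [p], [q], [r] say whether [b], [c], [d] lie on the side of [a]. A cut crossed by no edge must
     have all four vertices on that side. *)
  have cut (p q r : bool) :
      (adj a b -> p) -> (adj a c -> q) -> (adj a d -> r) ->
      (adj b c -> p = q) -> (adj b d -> p = r) -> (adj c d -> q = r) ->
      [&& p, q & r].
    move=> hab hac had hbc hbd hcd.
    have [A [Aa Ab Ac Ad]] :
        exists A : {set G}, [/\ a \in A, (b \in A) = p, (c \in A) = q & (d \in A) = r].
      exists [set x | [|| x == a, p && (x == b), q && (x == c) | r && (x == d)]].
      rewrite !inE !eqxx !(eq_sym b a) !(eq_sym c a) !(eq_sym d a) !(eq_sym c b).
      rewrite !(eq_sym d b) !(eq_sym d c) (negPf ab) (negPf ac) (negPf ad).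
      by rewrite (negPf bc) (negPf bd) (negPf cd) !(andbT, andbF, orbF).
    have /subsetP sXA : [set a; b; c; d] \subset A.
      apply: cutX => // x y; rewrite !inE -!orbA.
      case/or4P=> /eqP-> /or4P[]/eqP->; rewrite ?adj_irrefl // ?Aa ?Ab ?Ac ?Ad
        ?(adj_sym b a) ?(adj_sym c a) ?(adj_sym d a) ?(adj_sym c b) ?(adj_sym d b)
        ?(adj_sym d c) // => xy;
        first [move: (hab xy) | move: (hac xy) | move: (had xy) | move: (hbc xy)
              | move: (hbd xy) | move: (hcd xy)];
        by case: (p); case: (q); case: (r).
    by rewrite -Ab -Ac -Ad !sXA // !inE eqxx ?orbT.
  rewrite /spanning4.
  (* Each disconnected adjacency pattern leaves one of the seven proper cuts uncrossed; these are
     tried in turn. *)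
  move: cut; case: (adj a b); case: (adj a c); case: (adj a d);
  case: (adj b c); case: (adj b d); case: (adj c d) => // cut;
  by [have := cut false false false; apply | have := cut true false false; apply
     |have := cut false true false; apply | have := cut false false true; apply
     |have := cut true true false; apply | have := cut true false true; apply
     |have := cut false true true; apply].
have step x y : x \in [set a; b; c; d] -> y \in [set a; b; c; d] -> adj x y ->
    (x \in A) = (y \in A).
  by move=> Xx Xy xy; apply/idP/idP; apply: closA; rewrite // adj_sym.
have Xb : b \in [set a; b; c; d] by rewrite !inE eqxx orbT.
have Xc : c \in [set a; b; c; d] by rewrite !inE eqxx orbT.
have Xd : d \in [set a; b; c; d] by rewrite !inE eqxx orbT.
have [Ab Ac Ad] : [/\ b \in A, c \in A & d \in A].
  apply/and3P; move: span; rewrite /spanning4.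
  have := step _ _ Xc Xd; have := step _ _ Xb Xd; have := step _ _ Xb Xc.
  have := step _ _ Xa Xd; have := step _ _ Xa Xc; have := step _ _ Xa Xb.
  (* If [A] missed one of [b], [c], [d], it would be a cut that some edge crosses by [span] and that
     no edge crosses by [step]. *)
  rewrite Aa; case: (b \in A); case: (c \in A); case: (d \in A) => //;
    case: (adj a b) => [/(_ isT) ? //|_]; case: (adj a c) => [/(_ isT) ? //|_];
    case: (adj a d) => [/(_ isT) ? //|_]; case: (adj b c) => [/(_ isT) ? //|_];
    case: (adj b d) => [/(_ isT) ? //|_]; by case: (adj c d) => [/(_ isT) ? //|_].
by apply/subsetP=> x; rewrite !inE -!orbA => /or4P[] /eqP->.
Qed.

(** * Paths, claws and 4-cycles as conditions on quadruples *)

Section FourVertexPatterns.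
Variable G : sgraph.

Definition path_edges (p : G * G * G * G) : bool :=
  let: (a, b, c, d) := p in [&& adj a b, adj b c & adj c d].

(** Only the chord [a d] is excluded: in a triangle-free graph the chords [a c] and [b d] cannot
    occur. *)
Definition induced_path_edges (p : G * G * G * G) : bool :=
  let: (a, b, c, d) := p in path_edges p && ~~ adj a d.

Definition claw_edges (p : G * G * G * G) : bool :=
  let: (a, b, c, d) := p in [&& adj a b, adj a c & adj a d].

Definition cycle_edges (p : G * G * G * G) : bool :=
  let: (a, b, c, d) := p in path_edges p && adj a d.

Lemma card_embeddings_P4 : #|embeddings P4 G| = count4 path_edges.
Proof.
rewrite card_quads; apply: eq_bigr => -[[[a b] c] d] _; congr nat_of_bool.
rewrite inE injectiveb_quad; congr (_ && _).
apply/forallP/and3P => [hom|[ab bc cd] u].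
  have edge (i j : 'I_4) : @adj P4 i j ->
      adj (nth a [:: a; b; c; d] i) (nth a [:: a; b; c; d] j).
    by move=> ij; move/forallP/(_ j)/implyP/(_ ij): (hom i); rewrite !ffunE.
  by split; [apply: (edge (@Ordinal 4 0 isT) (@Ordinal 4 1 isT))
    | apply: (edge (@Ordinal 4 1 isT) (@Ordinal 4 2 isT))
    | apply: (edge (@Ordinal 4 2 isT) (@Ordinal 4 3 isT))].
apply/forallP=> v; apply/implyP; rewrite !ffunE.
by case: u v => [[|[|[|[|m]]]] ?] [[|[|[|[|m']]]] ?] //= _ //; rewrite adj_sym.
Qed.

Lemma card_embeddings_C4 : #|embeddings C4 G| = count4 cycle_edges.
Proof.
rewrite card_quads; apply: eq_bigr => -[[[a b] c] d] _; congr nat_of_bool.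
rewrite inE injectiveb_quad; congr (_ && _).
rewrite /cycle_edges /path_edges -!andbA; apply/forallP/and4P => [hom|[ab bc cd ad] u].
  have edge (i j : 'I_4) : @adj C4 i j ->
      adj (nth a [:: a; b; c; d] i) (nth a [:: a; b; c; d] j).
    by move=> ij; move/forallP/(_ j)/implyP/(_ ij): (hom i); rewrite !ffunE.
  by split; [apply: (edge (@Ordinal 4 0 isT) (@Ordinal 4 1 isT))
    | apply: (edge (@Ordinal 4 1 isT) (@Ordinal 4 2 isT))
    | apply: (edge (@Ordinal 4 2 isT) (@Ordinal 4 3 isT))
    | apply: (edge (@Ordinal 4 0 isT) (@Ordinal 4 3 isT))].
apply/forallP=> v; apply/implyP; rewrite !ffunE.
by case: u v => [[|[|[|[|m]]]] ?] [[|[|[|[|m']]]] ?] //= _ //; rewrite adj_sym.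
Qed.

(** The split is on whether [a d] closes the path. A 4-cycle is counted 8 times, as it has 8
    labellings, and equally as 4 copies of P4 with 2 orientations each. *)
Lemma count4_path :
  count4 path_edges = count4 induced_path_edges + count4 cycle_edges.
Proof.
rewrite /count4 -big_split; apply: eq_bigr => -[[[a b] c] d] _.
rewrite /induced_path_edges /cycle_edges.
by case: (uniq4 _); case: (path_edges _); case: (adj a d).
Qed.

(** A connected triangle-free adjacency pattern on four labels matches exactly one of the 12 + 4 + 3
    labelled copies, and a disconnected one matches none; this is a check over the six possible
    edges. *)
Lemma spanning4_decomp (a b c d : G) :
  (forall x y z : G, ~~ [&& adj x y, adj y z & adj x z]) ->
  spanning4 a b c d =
    \sum_(s <- paths4) induced_path_edges (permute4 s (a, b, c, d))
    + \sum_(s <- claws4) claw_edges (permute4 s (a, b, c, d))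
    + \sum_(s <- cycles4) cycle_edges (permute4 s (a, b, c, d)) :> nat.
Proof.
move=> trfree; rewrite !big_cons !big_nil /= /spanning4.
move: (trfree a b c) (trfree a b d) (trfree a c d) (trfree b c d).
rewrite ?(adj_sym b a) ?(adj_sym c a) ?(adj_sym d a) ?(adj_sym c b) ?(adj_sym d b)
  ?(adj_sym d c).
by case: (adj a b); case: (adj a c); case: (adj a d); case: (adj b c);
  case: (adj b d); case: (adj c d).
Qed.

(** This peels off the innermost sum of a count: [P] holds the constraints on the vertices already
    chosen, and the number [m] of continuations may depend on them being met. *)
Lemma sum_andb (T : finType) (P : bool) (Q : pred T) (m : nat) :
  (P -> #|Q| = m) -> \sum_x (P && Q x : nat) = P * m.
Proof.
case: P => [/(_ isT) <- | _]; last by rewrite big1.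
rewrite mul1n -sum1_card [RHS]big_mkcond.
by apply: eq_bigr => x _; rewrite -[x \in Q]/(Q x); case: (Q x).
Qed.

Lemma sum_quads (T : finType) (F : T * T * T * T -> nat) :
  \sum_p F p = \sum_a \sum_b \sum_c \sum_d F (a, b, c, d).
Proof.
by rewrite !pair_big; apply: eq_bigr => -[[[a b] c] d].
Qed.

(** * Path and claw counts from regularity and bipartiteness *)

Variable k : nat.
Hypothesis regG : regular k G.

Lemma card_nbhd (x : G) : #|[pred y | adj x y]| = k.
Proof. by rewrite -(regG x); apply: eq_card => y; rewrite inE. Qed.

Lemma card_nbhdD1 (x u : G) : adj x u -> #|[pred y | adj x y & y != u]| = k.-1.
Proof.
move=> xu; rewrite -(card_nbhd x) [in RHS](cardD1 u) inE xu /=.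
by apply: eq_card => y; rewrite !inE andbC.
Qed.

(** The truncated [k.-2] is exact here, since two distinct neighbours of [x] force [k] to be at
    least 2. *)
Lemma card_nbhdD2 (x u v : G) : adj x u -> adj x v -> u != v ->
  #|[pred y | adj x y & (y != u) && (y != v)]| = k.-2.
Proof.
move=> xu xv uv; rewrite -(card_nbhd x) [in RHS](cardD1 u) inE xu /= [in RHS](cardD1 v).
rewrite !inE eq_sym uv xv /=.
by apply: eq_card => y; rewrite !inE; case: (y == u); case: (y == v); case: (adj x y).
Qed.

Lemma count4_claw_regular : count4 claw_edges = #|G| * k * k.-1 * k.-2.
Proof.
rewrite /count4 sum_quads.
under eq_bigr => a _.
  under eq_bigr => b _.
    under eq_bigr => c _.
      rewrite (eq_bigr (fun d => ([&& adj a b, adj a c & b != c] &&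
          [&& adj a d, d != b & d != c] : nat))); last first.
        move=> d _; rewrite /= !inE !negb_or andbT; congr nat_of_bool.
        (* The centre differs from its leaves by irreflexivity, so only the inequalities between
           leaves remain; they leave [k], [k.-1] and [k.-2] choices in turn. *)
        have neq x : adj a x -> a != x by apply: contraTneq => ->; rewrite adj_irrefl.
        move: (neq b) (neq c) (neq d); rewrite !(eq_sym d).
        case: (adj a b) => [-> //|_]; last by rewrite !andbF.
        case: (adj a c) => [-> //|_]; last by rewrite !andbF.
        case: (adj a d) => [-> //|_]; last by rewrite !andbF.
        by rewrite !andbT /=; case: (b != c); rewrite //= andbC.
      rewrite (sum_andb (m := k.-2)); last by case/and3P; apply: card_nbhdD2.
      over.
    rewrite -big_distrl /= (eq_bigr (fun c => (adj a b && (adj a c && (c != b)) : nat))).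
      rewrite (sum_andb (m := k.-1)); last exact: card_nbhdD1.
      over.
    by move=> c _; rewrite eq_sym.
  rewrite -!big_distrl /= (eq_bigr (fun b => (true && adj a b : nat))) //.
  rewrite (sum_andb (m := k)); last by rewrite card_nbhd.
  over.
by rewrite sum_nat_const mul1n !mulnA.
Qed.

Hypothesis bipG : bipartite G.

Lemma bipartite_triangle_free (x y z : G) : ~~ [&& adj x y, adj y z & adj x z].
Proof.
have [A bip] := bipG; apply/and3P=> -[/bip + /bip + /bip].
by case: (x \in A); case: (y \in A); case: (z \in A).
Qed.

Lemma count4_path_regular : count4 path_edges = #|G| * k * k.-1 * k.-1.
Proof.
have [A bip] := bipG.
rewrite /count4 sum_quads.
under eq_bigr => a _.
  under eq_bigr => b _.
    under eq_bigr => c _.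
      rewrite (eq_bigr (fun d => ([&& adj a b, adj b c & c != a] &&
          [&& adj c d & d != b] : nat))); last first.
        move=> d _; rewrite /= !inE !negb_or andbT; congr nat_of_bool.
        (* Sides alternate along the path, so four of the six inequalities, including [a != d], are
           automatic. Only [c != a] and [d != b] restrict the choices. *)
        have neq x y : (x \in A) != (y \in A) -> x != y.
          by apply: contraNneq => ->.
        move: (bip a b) (bip b c) (bip c d) (neq a b) (neq b c) (neq c d) (neq a d).
        rewrite (eq_sym c a) (eq_sym d b).
        case: (adj a b) => [/(_ isT) hab|_]; last by rewrite !andbF.
        case: (adj b c) => [/(_ isT) hbc|_]; last by rewrite !andbF.
        case: (adj c d) => [/(_ isT) hcd|_]; last by rewrite !andbF.
        move=> -> // -> // -> // ->.
          by rewrite !andbT /=.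
        by move: hab hbc hcd; case: (a \in A); case: (b \in A); case: (c \in A);
          case: (d \in A).
      rewrite (sum_andb (m := k.-1)); last first.
        by case/and3P=> _ bc _; apply: card_nbhdD1; rewrite adj_sym.
      over.
    rewrite -big_distrl /= (sum_andb (m := k.-1)); last first.
      by move=> ab; apply: card_nbhdD1; rewrite adj_sym.
    over.
  rewrite -!big_distrl /= (eq_bigr (fun b => (true && adj a b : nat))) //.
  rewrite (sum_andb (m := k)); last by rewrite card_nbhd.
  over.
by rewrite sum_nat_const mul1n !mulnA.
Qed.

(** Summing the decomposition over quadruples gives 12 times the induced paths, 4 times the claws
    and 3 times the cycles. Replacing induced paths by all paths adds 12 times the cycles, and the
    surplus 9 = 12 - 3 is put on the left to avoid subtraction. *)
Lemma connected_sets4 :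
  24 * #|[set X : {set G} | #|X| == 4 & num_components (induced X) == 1]|
    + 9 * count4 cycle_edges = 12 * count4 path_edges + 4 * count4 claw_edges.
Proof.
rewrite (@card_sets4 _ (fun X => num_components (induced X) == 1)).
have -> : count4 (fun p : G * G * G * G => let: (a, b, c, d) := p in
                           num_components (induced [set a; b; c; d]) == 1) =
    \sum_(s <- paths4) count4 induced_path_edges
    + \sum_(s <- claws4) count4 claw_edges
    + \sum_(s <- cycles4) count4 cycle_edges.
  rewrite -!sum_permute4 // -!big_split /=; apply: eq_bigr => -[[[a b] c] d] _.
  rewrite -!mulnDr -spanning4_decomp; last exact: bipartite_triangle_free.
  by rewrite mulnb; case U: (uniq4 _) => //; rewrite num_components_set4.
rewrite !big_cons !big_nil count4_path; lia.
Qed.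
End FourVertexPatterns.

Theorem theorem3p4 (k n : nat) (G G' : sgraph) :
  (0 < k)%N -> (0 < n)%N ->
  #|G| = n -> regular k G -> bipartite G ->
  #|G'| = n -> regular k G' -> bipartite G' ->
  subgraph_component_poly G' = subgraph_component_poly G ->
  num_subgraphs C4 G = num_subgraphs C4 G' /\
  num_subgraphs P4 G = num_subgraphs P4 G'.
Proof.
move=> _ _ oG regG bipG oG' regG' bipG' eqQ.
have eq_path : count4 (@path_edges G) = count4 (@path_edges G').
  by rewrite (count4_path_regular regG bipG) (count4_path_regular regG' bipG') oG oG'.
have eq_claw : count4 (@claw_edges G) = count4 (@claw_edges G').
  by rewrite (count4_claw_regular regG) (count4_claw_regular regG') oG oG'.
(* The coefficient of x^4 y counts the connected induced subgraphs on four vertices. *)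
have /eqP : (((subgraph_component_poly G)`_4)`_1 =
             ((subgraph_component_poly G')`_4)`_1)%R by rewrite eqQ.
rewrite !coef_subgraph_component_poly Num.Theory.eqr_nat => /eqP eq_conn.
split; apply: num_subgraphs_eq; last by rewrite !card_embeddings_P4.
rewrite !card_embeddings_C4.
(* In the two identities all terms but the cycle terms agree, so the common summand and the factor 9
   cancel. *)
have := connected_sets4 bipG; have := connected_sets4 bipG'.
rewrite eq_conn eq_path eq_claw => <- /eqP.
by rewrite eqn_add2l eqn_pmul2l // => /eqP.
Qed.
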